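(* For every $n\in\mathbb{N}$, $P\in\mathbb{N}_0$ and $Q\in\{-P-1,\dots,0\}$, $$\sum_{d\mid n}\varphi\!\left(\frac nd\right)V_d(P,Q)\equiv0\pmod n.$$ In particular, if $n$ is a prime number, then $$V_n(P,Q)\equiv P\pmod n.$$
   Context: $\mathbb{N}$ denotes the positive integers and $\mathbb{N}_0=\mathbb{N}\cup\{0\}$. $\varphi$ is Euler's totient function, and the sum runs over the positive divisors $d$ of $n$. For integers $P,Q$, the Lucas sequence of the second kind is defined by $V_0(P,Q)=2$, $V_1(P,Q)=P$, and $V_n(P,Q)=P\,V_{n-1}(P,Q)-Q\,V_{n-2}(P,Q)$ for $n>1$. *)

(* Defs.v *)
From mathcomp Require Import all_boot all_order all_algebra.

Set Implicit Arguments.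
Unset Strict Implicit.
Unset Printing Implicit Defensive.

Import Order.TTheory GRing.Theory Num.Theory.

Local Open Scope ring_scope.

Fixpoint lucasV (P Q : int) (n : nat) : int :=
  match n with
  | 0 => 2
  | 1 => P
  | (m.+1 as k).+1 => P * lucasV P Q k - Q * lucasV P Q m
  end.

(* Main.v *)
(* V_d(P, Q) is the trace of the d-th power of A = [[P, -Q], [1, 0]], that is,
   the number of closed edge walks of length d in the multigraph with adjacency
   matrix A. The cyclic group Z/n rotates the closed walks of length n, and
   those fixed by the rotation a are the periodic extensions of the closed walks
   of length gcd(a, n). By Burnside's lemma the sum of V_gcd(a, n) over a in Z/n
   is n times a number of orbits, and exactly phi(n/d) residues a satisfy
   gcd(a, n) = d. *)

Require Import Defs.
From mathcomp Require Import all_boot all_order all_algebra all_fingroup.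
From mathcomp Require Import zify ring.

Import Order.TTheory GRing.Theory Num.Theory.

Local Open Scope nat_scope.

(** Multiplication by d carries the residues modulo n/d that are coprime to n/d bijectively onto
    these a. *)
Lemma card_gcdn_eq (n d : nat) : 0 < n -> d %| n ->
  #|[set a : 'I_n | gcdn a n == d]| = totient (n %/ d).
Proof.
move=> n_gt0 d_dvd; have d_gt0 := dvdn_gt0 n_gt0 d_dvd.
have nE : n = n %/ d * d by rewrite divnK.
have ltd (i : 'I_(n %/ d)) : i * d < n by rewrite {2}nE ltn_pmul2r.
rewrite totient_count_coprime big_mkord -sum1dep_card.
rewrite (eq_bigr (fun i : 'I_(n %/ d) => if coprime (n %/ d) i then 1 else 0)); last first.
  by move=> i _; case: coprime.
rewrite -big_mkcond /=.
have injd : injective (fun i => Ordinal (ltd i)).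
  by move=> i j [] /eqP; rewrite eqn_pmul2r // => /eqP/val_inj.
rewrite !sum1dep_card -(card_imset _ injd); apply: eq_card => a.
rewrite !inE; apply/eqP/imsetP => [gE | [i]].
  have da : d %| a by rewrite -gE dvdn_gcdl.
  have lta : a %/ d < n %/ d by rewrite ltn_divLR // divnK.
  exists (Ordinal lta); last by apply: val_inj; rewrite /= divnK.
  rewrite inE /= coprime_sym /coprime -(eqn_pmul2r d_gt0) muln_gcdl !divnK //.
  by rewrite gE mul1n.
rewrite inE coprime_sym => /eqP co ->.
by rewrite /= {2}nE -muln_gcdl co mul1n.
Qed.

Lemma sum_gcdn (n : nat) (F : nat -> nat) : 0 < n ->
  \sum_(a < n) F (gcdn a n) = \sum_(d <- divisors n) totient (n %/ d) * F d.
Proof.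
move=> n_gt0.
transitivity (\sum_(a < n) \sum_(d <- divisors n | gcdn a n == d) F d).
  apply: eq_bigr => a _; under eq_bigl do rewrite eq_sym.
  rewrite big_mkcond (bigD1_seq (gcdn a n)) ?divisors_uniq -?dvdn_divisors ?dvdn_gcdr //=.
  by rewrite eqxx big1 ?addn0 // => d /negbTE->.
rewrite (exchange_big_dep xpredT) //= big_seq [RHS]big_seq.
apply: eq_bigr => d; rewrite -dvdn_divisors // => dn.
by rewrite sum_nat_const -card_gcdn_eq // cardsE.
Qed.

Section CyclicWords.

Variables (T : finType) (e : rel T).

(** Words are functions on ['I_n] so that rotation is addition in Z/n; [ordS] is the cyclic
    successor, so the last letter must also be related to the first. *)
Definition closed_words n : {set {ffun 'I_n -> T}} :=
  [set f : {ffun 'I_n -> T} | [forall i, e (f i) (f (ordS i))]].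

Section Rotation.

Variable m : nat.
Local Notation n := m.+1.

Definition rotw (f : {ffun 'I_n -> T}) (a : 'I_n) : {ffun 'I_n -> T} :=
  [ffun i => f (a + i)%R].

Lemma rotw1 f : rotw f 1%g = f.
Proof. by apply/ffunP => i; rewrite ffunE add0r. Qed.

Lemma rotwM f : act_morph rotw f.
Proof. by move=> a b; apply/ffunP => i; rewrite !ffunE addrA. Qed.

Definition rotw_action := TotalAction rotw1 rotwM.

Lemma addS_Zp (a i : 'I_n) : (a + ordS i)%R = ordS (a + i)%R.
Proof. by apply: val_inj; rewrite /= modnDmr addnS -[in RHS]addn1 modnDml addn1. Qed.

Lemma acts_rotw : [acts [set: 'I_n], on closed_words n | rotw_action].
Proof.
apply/subsetP => a _; rewrite !inE; apply/subsetP => f; rewrite !inE.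
move=> /forallP ef; apply/forallP => i.
by rewrite /= !ffunE addS_Zp.
Qed.

Lemma periodic_gcdn (f : {ffun 'I_n -> T}) (a : 'I_n) : rotw f a = f ->
  forall k, f (inZp (k %% gcdn a n)) = f (inZp k).
Proof.
move=> fa.
have fA k : f (inZp (k + a)) = f (inZp k).
  rewrite -[in RHS]fa ffunE; congr (f _); apply: val_inj.
  by rewrite /= modnDmr addnC.
have fbA b k : f (inZp (k + b * a)) = f (inZp k).
  by elim: b => [|b IH]; rewrite ?addn0 // mulSnr addnA fA.
(* Here n divides gcd(a, n) + b a, so a shift by the gcd followed by b shifts by a is trivial; this
   avoids subtraction. *)
have [b _ nb] := Bezoutl a (ltn0Sn m).
have fg k : f (inZp (k + gcdn a n)) = f (inZp k).
  rewrite -(fbA b) -addnA gcdnC; congr (f _); apply: val_inj => /=.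
  by rewrite -modnDmr (eqP nb) addn0.
move=> k; rewrite [in RHS](divn_eq k (gcdn a n)) addnC.
by elim: (k %/ _) => [|j IH]; rewrite ?addn0 // mulSnr addnA fg.
Qed.

(** Since g = gcd(a, n) divides n, reduction modulo g commutes with the cyclic successor, even at
    the wrap-around, so periodic extension [ext] keeps words closed. That it reaches every fixed
    word is [periodic_gcdn]. *)
Lemma card_fix_rotw (a : 'I_n) :
  #|('Fix_(closed_words n | rotw_action)[a])%g| = #|closed_words (gcdn a n)|.
Proof.
have g_gt0 : 0 < gcdn a n by rewrite gcdn_gt0 orbT.
have gn : gcdn a n %| n := dvdn_gcdr a n.
have ga : gcdn a n %| a := dvdn_gcdl a n.
pose red k := Ordinal (ltn_pmod k g_gt0).
pose ext (h : {ffun 'I_(gcdn a n) -> T}) : {ffun 'I_n -> T} := [ffun i : 'I_n => h (red i)].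
have redn k : red (k %% n) = red k by apply: val_inj; rewrite /= modn_dvdm.
have redid (j : 'I_(gcdn a n)) : red j = j by apply: val_inj; rewrite /= modn_small.
have redS k : ordS (red k) = red k.+1.
  by apply: val_inj; rewrite /= -addn1 modnDml addn1.
have ext_inj : injective ext.
  move=> h1 h2 /ffunP h12; apply/ffunP => j.
  by have := h12 (inZp j); rewrite !ffunE /= redn redid.
rewrite -(card_imset _ ext_inj); apply: eq_card => f.
rewrite in_setI; apply/andP/imsetP => [[+ /afix1P/= fa] | [h]].
  rewrite inE => /forallP ef.
  exists [ffun j : 'I_(gcdn a n) => f (inZp j)].
    rewrite inE; apply/forallP => j; rewrite !ffunE /= periodic_gcdn //.
    by have := ef (inZp j); congr (e _ (f _)); apply: val_inj; rewrite /= -addn1 modnDml addn1.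
  by apply/ffunP => i; rewrite !ffunE /= periodic_gcdn // valZpK.
rewrite inE => /forallP eh ->; split.
  by rewrite inE; apply/forallP => i; rewrite !ffunE /= redn -redS.
apply/afix1P => /=; apply/ffunP => i; rewrite !ffunE /= redn; congr (h _).
by apply: val_inj; rewrite /= -modnDml (eqP ga).
Qed.

End Rotation.

Lemma dvdn_sum_closed_words (n : nat) : 0 < n ->
  n %| \sum_(d <- divisors n) totient (n %/ d) * #|closed_words d|.
Proof.
case: n => // m n_gt0; rewrite -(sum_gcdn _ (fun d => #|closed_words d|)) //.
(* Burnside's lemma for Z/n, a group of order n. *)
have := Frobenius_Cauchy (acts_rotw m).
rewrite cardsT card_ord (eq_bigl xpredT); last by move=> a; rewrite inE.
by under eq_bigr do rewrite card_fix_rotw; move=> ->; apply: dvdn_mull.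
Qed.

Lemma sum_tuple_cons (n : nat) (F : seq T -> nat) :
  \sum_(t : n.+1.-tuple T) F t = \sum_x \sum_(t : n.-tuple T) F (x :: t).
Proof.
rewrite pair_big /= (reindex (fun p : T * n.-tuple T => [tuple of p.1 :: p.2])) //=.
exists (fun t => (thead t, [tuple of behead t])) => [[x t] _ | t _] /=.
  by congr (_, _); apply: val_inj.
by rewrite [RHS]tuple_eta; apply: val_inj.
Qed.

(** Passes from functions, on which rotation is simple, to sequences, which can be counted by
    recursion on the length. *)
Lemma card_closed_words (n : nat) :
  #|closed_words n| = \sum_(t : n.-tuple T) path.cycle e t.
Proof.
pose F (t : n.-tuple T) := [ffun i => tnth t i].
have F_bij : bijective F.
  exists (fun f : {ffun 'I_n -> T} => [tuple f i | i < n]) => [t | f].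
    by apply: eq_from_tnth => i; rewrite tnth_mktuple ffunE.
  by apply/ffunP => i; rewrite ffunE tnth_mktuple.
rewrite -sum1_card (reindex F) /=; last exact: onW_bij.
rewrite big_mkcond; apply: eq_bigr => t _; rewrite inE.
suff -> : [forall i, e (F t i) (F t (ordS i))] = path.cycle e t by case: path.cycle.
case: n t @F F_bij => [|n] t F _.
  by rewrite tuple0; apply/forallP => -[].
case/tupleP: t => x t.
have stepE (i : 'I_n.+1) : e (F [tuple of x :: t] i) (F [tuple of x :: t] (ordS i))
    = e (nth x (x :: rcons t x) i) (nth x (rcons t x) i).
  rewrite !ffunE !(tnth_nth x) /= -rcons_cons !nth_rcons /= size_tuple ltn_ord.
  (* At the last index the successor wraps around to 0, matching the [x] appended by [rcons]. *)
  have := ltn_ord i; rewrite leq_eqVlt => /orP[/eqP [->] | lt_in].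
    by rewrite modnn ltnn eqxx.
  by rewrite modn_small // (lt_in : _ < n).
apply/forallP/(pathP x) => [et i | et i]; last first.
  by rewrite stepE; apply: et; rewrite size_rcons size_tuple.
rewrite size_rcons size_tuple => lt_in.
by rewrite -(stepE (Ordinal lt_in)).
Qed.

End CyclicWords.

(* The two-vertex multigraph with adjacency matrix [[p, q], [1, 0]], the vertices
   being the booleans, false first. *)
Section LucasGraph.

Variables p q : nat.

(** The letters are edges rather than vertices, so that parallel edges count separately. *)
Definition edge : finType := ('I_p + 'I_q + unit)%type.
Definition src (x : edge) : bool := if x is inr _ then true else false.
Definition tgt (x : edge) : bool := if x is inl (inr _) then true else false.
Definition follows : rel edge := fun x y => tgt x == src y.

(** The (a, b) entry of the n-th power of the adjacency matrix, expanded along the first step. *)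
Fixpoint walks (n : nat) (a b : bool) : nat :=
  if n is k.+1 then
    if a then walks k false b else p * walks k false b + q * walks k true b
  else (a == b).

Lemma sum_edge (F : bool -> bool -> nat) :
  \sum_x F (src x) (tgt x) = p * F false false + q * F false true + F true false.
Proof.
by rewrite big_sumType /= big_sumType /= !sum_nat_const !card_ord card_unit mul1n.
Qed.

Lemma sum_path_follows (n : nat) (x y : edge) :
  \sum_(t : n.-tuple edge) path follows x (rcons t y) = walks n (tgt x) (src y).
Proof.
elim: n x => [|n IH] x.
  rewrite (big_pred1 [tuple]) => [|t]; last by rewrite (tuple0 t); exact/esym/eqxx.
  by rewrite /= andbT.
rewrite (sum_tuple_cons _ _ (fun t => path follows x (rcons t y) : nat)) /=.
transitivity (\sum_z (tgt x == src z) * walks n (tgt z) (src y)).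
  apply: eq_bigr => z _; rewrite -IH big_distrr; apply: eq_bigr => t _.
  by rewrite /= mulnb.
rewrite (sum_edge (fun a b => (tgt x == a) * walks n b (src y))).
by case: (tgt x); rewrite /= !(mul0n, mul1n, muln0, addn0, add0n).
Qed.

(** Sort by the first edge: the other n edges form a walk from its target back to its source. *)
Lemma card_closed_walks (n : nat) :
  #|closed_words edge follows n.+1|
    = p * walks n false false + q * walks n true false + walks n false true.
Proof.
rewrite card_closed_words (sum_tuple_cons _ _ (fun t => path.cycle follows t : nat)) /=.
under eq_bigr do rewrite sum_path_follows.
exact: (sum_edge (fun a b => walks n b a)).
Qed.

(* Cayley-Hamilton for the adjacency matrix. *)
Lemma walksSS (n : nat) (a b : bool) :
  walks n.+2 a b = p * walks n.+1 a b + q * walks n a b.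
Proof. by case: a. Qed.

Local Open Scope ring_scope.

(** Both sides obey the same recurrence and agree at lengths 1 and 2. Length 0 is excluded: there is
    one empty word, but V_0 = 2. *)
Lemma card_closed_walks_lucasV (n : nat) : (0 < n)%N ->
  #|closed_words edge follows n|%:Z = lucasV p%:Z (- q%:Z) n.
Proof.
case: n => // n _; rewrite card_closed_walks.
elim/ltn_ind: n => -[|[|n]] IH.
- by rewrite /= !(muln0, muln1, addn0).
- by rewrite /= !(muln0, muln1, addn0, add0n); lia.
have -> : lucasV p%:Z (- q%:Z) n.+3
  = p%:Z * lucasV p%:Z (- q%:Z) n.+2 + q%:Z * lucasV p%:Z (- q%:Z) n.+1.
  by rewrite -[X in _ = _ + X]opprK -mulNr.
rewrite -!IH // !walksSS; lia.
Qed.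

End LucasGraph.

Local Open Scope ring_scope.

Theorem corollary2 (n : nat) (P Q : int) (n_gt0 : (0 < n)%N)
    (P_ge0 : 0 <= P) (Q_range : - P - 1 <= Q <= 0) :
  (\sum_(d <- divisors n) (totient (n %/ d)%N)%:Z * lucasV P Q d
     = 0 %[mod n%:Z])%Z
  /\ (prime n -> (lucasV P Q n = P %[mod n%:Z])%Z).
Proof.
have main : (\sum_(d <- divisors n) (totient (n %/ d)%N)%:Z * lucasV P Q d
     = 0 %[mod n%:Z])%Z.
  (* By the signs of P and Q, the matrix entries P and -Q are natural numbers, hence edge
     multiplicities. *)
  have -> : P = `|P|%N%:Z by lia.
  have -> : Q = - `|Q|%N%:Z by lia.
  apply/eqP; rewrite eqz_mod_dvd subr0.
  have := dvdn_sum_closed_words _ (follows `|P| `|Q|) _ n_gt0.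
  congr (_ %| _)%N.
  rewrite big_seq [in RHS]big_seq -[LHS]/(`|Posz _|)%N.
  congr absz; rewrite (big_morph Posz PoszD (erefl 0)).
  apply: eq_bigr => d; rewrite -dvdn_divisors // => dn.
  by rewrite PoszM card_closed_walks_lucasV // (dvdn_gt0 n_gt0).
split=> // n_prime; move: main.
have divE : perm_eq (divisors n) [:: 1%N; n].
  apply: uniq_perm; first exact: divisors_uniq.
    by rewrite /= inE andbT neq_ltn prime_gt1.
  move=> d; rewrite -dvdn_divisors // !inE.
  by apply/idP/orP => [/(primeP n_prime).2/orP // | [] /eqP->]; rewrite ?dvd1n.
rewrite (perm_big _ divE) big_cons big_seq1 /= divn1 divnn n_gt0 totient_prime //.
move=> /eqP; rewrite eqz_mod_dvd subr0 => nS.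
apply/eqP; rewrite eqz_mod_dvd.
(* For n prime the divisor sum is (n - 1) P + V_n, which exceeds V_n - P by n P. *)
have -> : lucasV P Q n - P
  = n.-1%:Z * P + (totient 1)%:Z * lucasV P Q n - n%:Z * P.
  rewrite -[totient 1]/1%N; have -> : n.-1%:Z = n%:Z - 1 by lia.
  ring.
by rewrite rpredB // dvdz_mulr.
Qed.
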